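(* Let $\mathcal L=\langle F,M,\mathrm{mng},\models\rangle$ be any logic with set of atomic formulas $P$, formula algebra $\mathfrak F$ and tautological congruence $\sim_{\mathcal L}$. Then: (i) $\mathfrak F/\!\sim_{\mathcal L}=\mathfrak{Fr}(\mathrm{Alg}_m(\mathcal L),P,\sim_{\mathcal L})$, i.e. $\sim_{\mathcal L}=\mathrm{Cr}(\mathrm{Alg}_m(\mathcal L),P,\sim_{\mathcal L})$; (ii) $\mathfrak F/\mathrm{si}(\sim_{\mathcal L})=\mathfrak{Fr}(\mathrm{Alg}_m(\mathcal L),P)$, i.e. $\mathrm{si}(\sim_{\mathcal L})=\mathrm{Cr}(\mathrm{Alg}_m(\mathcal L),P,\emptyset)$; (iii) $\mathrm{si}(\sim_{\mathcal L})=\{\langle\phi,\psi\rangle\in F\times F:\ \mathrm{Alg}_m(\mathcal L)\models[\phi=\psi]\}$, where $[\phi=\psi]$ is the equation in the language of type $\mathrm{Cn}$ obtained by regarding the atomic formulas (elements of $P$) as algebraic variables.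
   Context: A logic is a tuple $\mathcal L=\langle F,M,\mathrm{mng},\models\rangle$ where: $\mathrm{Cn}$ is a similarity type (the connectives) and $P$ is a set (the atomic formulas) such that no $p\in P$ is a term built by the connectives from elements of $P\setminus\{p\}$; $F$ is the universe of the term algebra $\mathfrak F=\mathfrak F(P,\mathrm{Cn})$ (absolutely free over $P$), called the formula algebra; $M$ is a class (of models); $\models\subseteq M\times F$ (validity); and $\mathrm{mng}$ assigns to each $\mathfrak M\in M$ a homomorphism $\mathrm{mng}_{\mathfrak M}$ from $\mathfrak F$ into some algebra of type $\mathrm{Cn}$, such that $\mathrm{mng}_{\mathfrak M}(\phi)=\mathrm{mng}_{\mathfrak M}(\psi)$ and $\mathfrak M\models\phi$ imply $\mathfrak M\models\psi$. The tautological congruence is $\sim_{\mathcal L}=\bigcap_{\mathfrak M\in M}\ker(\mathrm{mng}_{\mathfrak M})$. $\mathrm{Alg}_m(\mathcal L)=\{\mathrm{mng}_{\mathfrak M}(\mathfrak F):\mathfrak M\in M\}$ (the image algebras, called meaning algebras). $\mathrm{si}(\sim_{\mathcal L})=\{\langle\phi,\psi\rangle: \langle h(\phi),h(\psi)\rangle\in\sim_{\mathcal L}\text{ for every endomorphism } h \text{ of }\mathfrak F\}$. For a class $\mathsf K$ of algebras of type $\mathrm{Cn}$ and $S\subseteq F\times F$: $\mathrm{Hom}(\mathfrak F,\mathsf K,S)$ is the class of homomorphisms $h$ from $\mathfrak F$ into members of $\mathsf K$ with $S\subseteq\ker(h)$; $\mathrm{Cr}(\mathsf K,P,S)=\bigcap\{\ker(h):h\in\mathrm{Hom}(\mathfrak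 F,\mathsf K,S)\}$; $\mathfrak{Fr}(\mathsf K,P,S)=\mathfrak F/\mathrm{Cr}(\mathsf K,P,S)$ (conditionally $\mathsf K$-free algebra), and $\mathfrak{Fr}(\mathsf K,P)=\mathfrak{Fr}(\mathsf K,P,\emptyset)$. *)

(* Defs.v *)
From mathcomp Require Import all_boot.
From mathcomp Require Import boolp classical_sets functions.

Set Implicit Arguments.
Unset Strict Implicit.
Unset Printing Implicit Defensive.

Local Open Scope classical_set_scope.

Record signature : Type := Signature {
  conn : Type;
  arity : conn -> nat }.

Record algebra (Cn : signature) : Type := Algebra {
  carrier :> Type;
  op : forall c : conn Cn, ('I_(arity c) -> carrier) -> carrier }.

Record hom (Cn : signature) (A B : algebra Cn) : Type := MkHom {
  hom_fun :> A -> B;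
  homP : forall (c : conn Cn) (a : 'I_(arity c) -> A),
    hom_fun (op a) = op (fun i => hom_fun (a i)) }.

Definition ker (Cn : signature) (A B : algebra Cn) (h : hom A B) : set (A * A) :=
  [set p | h p.1 = h p.2].

(* Atoms enter through a constructor, so that no atom is a compound term and
   the term algebra is absolutely free over [P]. *)
Inductive term (Cn : signature) (P : Type) : Type :=
  | Atom of P
  | App (c : conn Cn) of ('I_(arity c) -> term Cn P).

Definition term_algebra (Cn : signature) (P : Type) : algebra Cn :=
  @Algebra Cn (term Cn P) (@App Cn P).

Fixpoint eval (Cn : signature) (P : Type) (A : algebra Cn) (v : P -> A)
    (t : term Cn P) : A :=
  match t with
  | Atom p => v p
  | App c a => @op Cn A c (fun i => eval v (a i))
  end.

(* Classes of algebras are plain predicates: [set] is universe monomorphic, and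
   [set (algebra Cn)] would clash with carriers built from [set]. *)

(* The equation [s = t], with the elements of [P] as algebraic variables, is
   valid in every member of [K]. *)
Definition valid_equation (Cn : signature) (P : Type) (K : algebra Cn -> Prop)
    (s t : term Cn P) : Prop :=
  forall A : algebra Cn, K A -> forall v : P -> A, eval v s = eval v t.

Record congruence (Cn : signature) (A : algebra Cn) : Type := Congruence {
  congr_set : set (A * A);
  congr_refl : forall x, congr_set (x, x);
  congr_sym : forall x y, congr_set (x, y) -> congr_set (y, x);
  congr_trans : forall x y z,
    congr_set (x, y) -> congr_set (y, z) -> congr_set (x, z);
  congr_op : forall (c : conn Cn) (a b : 'I_(arity c) -> A),
    (forall i, congr_set (a i, b i)) -> congr_set (op a, op b) }.

Section Quotient.
Variables (Cn : signature) (A : algebra Cn) (th : congruence A).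

Definition quotient_carrier : Type :=
  {X : set A | exists x, X = [set y | congr_set th (x, y)]}.

Definition class_of (x : A) : quotient_carrier :=
  exist (fun X : set A => exists x, X = [set y | congr_set th (x, y)])
    [set y | congr_set th (x, y)] (ex_intro _ x erefl).

Definition repr_of (X : quotient_carrier) : A := sval (cid (svalP X)).

Definition quotient : algebra Cn :=
  @Algebra Cn quotient_carrier
    (fun c a => class_of (op (fun i => repr_of (a i)))).

Lemma class_ofP x y : class_of x = class_of y <-> congr_set th (x, y).
Proof.
split=> [/(congr1 sval)/= E|xy].
  suff: [set z | congr_set th (x, z)] y by [].
  by rewrite E; exact: congr_refl.
apply: eq_sig_hprop => [X p q|/=]; first exact: Prop_irrelevance.
apply/seteqP; split=> z /= h.
  exact: congr_trans (congr_sym xy) h.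
exact: congr_trans xy h.
Qed.

Lemma repr_ofK X : class_of (repr_of X) = X.
Proof. apply: eq_sig_hprop => [Y p q|/=]; first exact: Prop_irrelevance.
by rewrite /repr_of; case: cid. Qed.

Lemma class_of_op (c : conn Cn) (a : 'I_(arity c) -> A) :
  class_of (op a) = @op Cn quotient c (fun i => class_of (a i)).
Proof.
apply/class_ofP; apply: congr_op => i.
by apply/class_ofP; rewrite repr_ofK.
Qed.

Definition quotient_map : hom A quotient := @MkHom Cn A quotient class_of class_of_op.

End Quotient.

Section Image.
Variables (Cn : signature) (A B : algebra Cn) (h : hom A B).

Lemma range_op (c : conn Cn) (a : 'I_(arity c) -> B) :
  (forall i, range h (a i)) -> range h (op a).
Proof.
move=> ha; have /choice[b hb] : forall i, exists x, h x = a i.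
  by move=> i; have [x _ hx] := ha i; exists x.
by exists (op b) => //; rewrite homP; congr op; apply/funext.
Qed.

Definition image_algebra : algebra Cn :=
  @Algebra Cn {y : B | range h y}
    (fun c a => exist (range h) (op (fun i => sval (a i)))
                  (range_op (fun i => svalP (a i)))).

End Image.

Section FreeAlgebras.
Variables (Cn : signature) (K : algebra Cn -> Prop) (P : Type).
Let F := term_algebra Cn P.
Variable S : set (F * F).

Definition Hom (A : algebra Cn) (h : hom F A) : Prop :=
  K A /\ S `<=` ker h.

Definition Cr : set (F * F) :=
  [set p | forall (A : algebra Cn) (h : hom F A), Hom h -> ker h p].

Definition Cr_congruence : congruence F.
Proof.
exists Cr => [x A h _|x y xy A h /xy //|x y z xy yz A h Kh|c a b ab A h Kh] //=.
- exact: etrans (xy A h Kh) (yz A h Kh).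
- rewrite /ker /= (homP h a) (homP h b); congr op.
  by apply/funext => i; exact: ab.
Defined.

Definition Fr : algebra Cn := quotient Cr_congruence.

End FreeAlgebras.

Arguments Hom {Cn} K P S A h.
Arguments Cr {Cn} K P S.
Arguments Cr_congruence {Cn} K P S.
Arguments Fr {Cn} K P S.

Section SubstitutionInvariant.
Variables (Cn : signature) (P : Type).
Let F := term_algebra Cn P.

Definition si (S : set (F * F)) : set (F * F) :=
  [set p | forall h : hom F F, S (h p.1, h p.2)].

Definition si_congruence (th : congruence F) : congruence F.
Proof.
exists (si (congr_set th)) => [x h|x y xy h|x y z xy yz h|c a b ab h] /=.
- exact: congr_refl.
- exact: congr_sym (xy h).
- exact: congr_trans (xy h) (yz h).
- by rewrite (homP h a) (homP h b); apply: congr_op => i; exact: ab.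
Defined.

End SubstitutionInvariant.

Record logic : Type := Logic {
  Cn : signature;
  P : Type;
  M : Type;
  mng_alg : M -> algebra Cn;
  mng : forall m : M, hom (term_algebra Cn P) (mng_alg m);
  models : M -> term Cn P -> Prop;
  modelsP : forall (m : M) (phi psi : term Cn P),
    mng m phi = mng m psi -> models m phi -> models m psi }.

Section LogicDefs.
Variable L : logic.

Definition formula_algebra : algebra (Cn L) := term_algebra (Cn L) (P L).
Let F := formula_algebra.

Definition taut : set (F * F) := [set p | forall m : M L, ker (mng m) p].

Definition taut_congruence : congruence F.
Proof.
exists taut => [x m|x y xy m|x y z xy yz m|c a b ab m] //=.
- exact: esym (xy m).
- exact: etrans (xy m) (yz m).
- rewrite /ker /= (homP (mng m) a) (homP (mng m) b); congr op.
  by apply/funext => i; exact: ab.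
Defined.

Definition Algm (A : algebra (Cn L)) : Prop :=
  exists m : M L, A = image_algebra (mng m).

End LogicDefs.

Arguments Algm L A : clear implicits.
Arguments taut L _ : clear implicits.

(* Main.v *)
Require Import Defs.
From mathcomp Require Import all_boot.
From mathcomp Require Import boolp classical_sets functions.

Local Open Scope classical_set_scope.

(** A meaning algebra is the image of the formula algebra under [mng m], so
    [mng m] corestricts to a homomorphism onto it with the same kernel; this
    gives one inclusion of (i) and, after composing with endomorphisms, of (ii).
    For the other inclusion of (ii), a homomorphism from the free algebra into
    the image of [mng m] lifts through [mng m] to an endomorphism: choose
    preimages of the values at the atoms.  Finally, homomorphisms from the
    formula algebra are exactly evaluations, which gives (iii). *)

(** All fields besides the relation are proofs, so proof irrelevance settles them. This turns equal
    relations into literally equal quotient algebras. *)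
Lemma congruence_ext {C : signature} {A : algebra C} (th1 th2 : congruence A) :
  congr_set th1 = congr_set th2 -> th1 = th2.
Proof.
case: th1 => S1 r1 s1 t1 o1; case: th2 => S2 r2 s2 t2 o2 /= E.
by subst S2; congr Congruence; exact: Prop_irrelevance.
Qed.

Definition hom_comp {C : signature} {A B D : algebra C} (g : hom B D)
  (f : hom A B) : hom A D.
Proof. by exists (fun x => g (f x)) => c a; rewrite !homP. Defined.

Definition eval_hom {C : signature} {X : Type} {A : algebra C} (v : X -> A) :
  hom (term_algebra C X) A :=
  @MkHom C (term_algebra C X) A (eval v) (fun c a => erefl).

Lemma hom_evalE {C : signature} {X : Type} {A : algebra C}
    (h : hom (term_algebra C X) A) (t : term C X) :
  h t = eval (fun x => h (Atom C x)) t.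
Proof.
elim: t => [//|c a IH] /=.
by rewrite (homP h a); congr op; apply/funext => i; exact: IH.
Qed.

Lemma term_hom_ext {C : signature} {X : Type} {A : algebra C}
    (g h : hom (term_algebra C X) A) :
  (forall x, g (Atom C x) = h (Atom C x)) -> g =1 h.
Proof.
move=> gh t; rewrite (hom_evalE g) (hom_evalE h).
by congr eval; apply/funext.
Qed.

Section ImageHom.
Context {C : signature} {A B : algebra C} (f : hom A B).

Lemma image_ext (x y : image_algebra f) : sval x = sval y -> x = y.
Proof. by move=> E; apply: eq_sig_hprop => // z p q; exact: Prop_irrelevance. Qed.

Definition image_val : hom (image_algebra f) B :=
  @MkHom C (image_algebra f) B (fun y => sval y) (fun c a => erefl).

Definition corestrict : hom A (image_algebra f).
Proof.
exists (fun x => exist (range f) (f x) (ex_intro2 _ _ x I erefl)) => c a.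
by apply: image_ext => /=; rewrite homP.
Defined.

Lemma ker_corestrict : ker corestrict = ker f.
Proof.
by apply/seteqP; split=> p; [move/(congr1 sval) | move=> E; exact: image_ext].
Qed.

End ImageHom.

Lemma lift_through_image {C : signature} {X : Type} {A B : algebra C}
    (f : hom A B) (h : hom (term_algebra C X) (image_algebra f)) :
  exists e : hom (term_algebra C X) A, forall t, f (e t) = sval (h t).
Proof.
have /choice[g hg] : forall x, exists a, f a = sval (h (Atom C x)).
  by move=> x; have [a _ fa] := svalP (h (Atom C x)); exists a.
exists (eval_hom g) => t.
(* Both composites are homomorphisms into [B], and by [hg] they agree at the atoms. *)
exact: (term_hom_ext (hom_comp f (eval_hom g)) (hom_comp (image_val f) h) hg t).
Qed.

Lemma taut_Cr (L : logic) : taut L = Cr (Algm L) (P L) (taut L).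
Proof.
apply/seteqP; split=> p tp; first by move=> A h [_]; exact.
(* The corestriction of [mng m] is among the homomorphisms defining [Cr], as [taut L] lies in
   [ker (mng m)]. *)
move=> m; rewrite -ker_corestrict; apply: tp; split; first by exists m.
by rewrite ker_corestrict => q; exact.
Qed.

Lemma si_taut_Cr (L : logic) : si (taut L) = Cr (Algm L) (P L) set0.
Proof.
apply/seteqP; split=> p sp.
  move=> A h [[m E] _]; subst A; have [e he] := lift_through_image _ h.
  (* Since [e] is an endomorphism, [sp] puts the [e]-image of [p] in [ker (mng m)]. *)
  by apply: image_ext; rewrite -!he; exact: sp.
move=> e m; rewrite -ker_corestrict.
apply: (sp _ (hom_comp (corestrict (mng m)) e)).
by split; [exists m | exact: sub0set].
Qed.

Lemma Cr_valid_equation {C : signature} (K : algebra C -> Prop) (X : Type) :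
  Cr K X set0 = [set p | valid_equation K p.1 p.2].
Proof.
apply/seteqP; split=> p Kp A.
  by move=> KA v; apply: (Kp A (eval_hom v)); split=> //; exact: sub0set.
by move=> h [KA _]; rewrite /ker /= !(hom_evalE h); exact: Kp.
Qed.

Theorem theorem2p4 (L : logic) :
  (quotient (taut_congruence L) = Fr (Algm L) (P L) (taut L)
   /\ taut L = Cr (Algm L) (P L) (taut L))
  /\ (quotient (si_congruence (taut_congruence L))
        = Fr (Algm L) (P L) set0
      /\ si (taut L) = Cr (Algm L) (P L) set0)
  /\ si (taut L)
     = [set p : formula_algebra L * formula_algebra L
          | valid_equation (Algm L) p.1 p.2].
Proof.
split; last split; last by rewrite si_taut_Cr Cr_valid_equation.
- split; last exact: taut_Cr.
  (* [Fr] unfolds to a quotient by [Cr_congruence], so comparing the two relations suffices. *)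
  by congr quotient; apply: congruence_ext; exact: taut_Cr.
- split; last exact: si_taut_Cr.
  by congr quotient; apply: congruence_ext; exact: si_taut_Cr.
Qed.
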